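(* Let $A, B \in \mathbb{R}^{n\times n}$ and $b \in \mathbb{R}^n$. Suppose that $B$ is nonsingular, that $B^{-1}b \geq 0$ and $B^{-1}b \neq 0$, and that $\sigma_{\max}(A) < \sigma_{\min}(B)$. Then the generalized absolute value equation $Ax - B|x| = b$ has no solution $x \in \mathbb{R}^n$.
   Context: For a vector $x \in \mathbb{R}^n$, $|x|$ denotes the vector of component-wise absolute values of $x$. Vector inequalities are entrywise. $\sigma_{\max}$ and $\sigma_{\min}$ denote the maximum and minimum singular values of a matrix. *)

(* Defs.v *)
From HB Require Import structures.
From mathcomp Require Import all_boot all_order all_algebra.
From mathcomp Require Import all_classical all_reals.

Set Implicit Arguments.
Unset Strict Implicit.
Unset Printing Implicit Defensive.

Import Order.TTheory GRing.Theory Num.Theory.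

Local Open Scope classical_set_scope.
Local Open Scope ring_scope.

Definition absmx (R : realType) (n : nat) (x : 'cV[R]_n) : 'cV[R]_n :=
  \col_i `|x i 0|.

(* The singular values of A, as a set: multiplicities are irrelevant for the
   largest and the smallest one.  MathComp's [eigenvalue] refers to row
   (left) eigenvectors, which makes no difference as A^T *m A is symmetric. *)
Definition singular_values (R : realType) (n : nat) (A : 'M[R]_n) : set R :=
  [set Num.sqrt l | l in [set l | eigenvalue (A^T *m A) l]].

(* For 0 < n the set of singular values is finite and nonempty, so [sup] and
   [inf] are its maximum and minimum; for n = 0 it is empty and both are 0. *)
Definition sigma_max (R : realType) (n : nat) (A : 'M[R]_n) : R :=
  sup (singular_values A).

Definition sigma_min (R : realType) (n : nat) (A : 'M[R]_n) : R :=
  inf (singular_values A).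

(* Main.v *)
(* Put c = B^-1 b.  A solution x satisfies B z = A x for z = |x| + c, where
   z >= |x| entrywise, and z <> 0 since c is nonnegative and nonzero.  For s
   strictly between sigma_max A and sigma_min B this gives
     s^2 |z|^2 < |B z|^2 = |A x|^2 <= s^2 |x|^2 <= s^2 |z|^2,
   a contradiction.  The two outer estimates bound the forms x^T (A^T A) x and
   z^T (B^T B) z by eigenvalues, diagonalizing over R[i]. *)
Require Import Defs.
From HB Require Import structures.
From mathcomp Require Import all_boot all_order all_algebra.
From mathcomp Require Import all_classical all_reals.
From mathcomp Require Import complex polyrcf.
Set Implicit Arguments.
Unset Strict Implicit.
Unset Printing Implicit Defensive.
Import Order.TTheory GRing.Theory Num.Theory.
Local Open Scope ring_scope.
Local Open Scope sesquilinear_scope.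

(** Eigenvalues are roots of the monic characteristic polynomial, so its Cauchy bound applies. This
    is what makes the [sup] in [sigma_max] a genuine upper bound. *)
Lemma eigenvalue_bounded (F : rcfType) (n : nat) (M : 'M[F]_n) :
  exists K, forall l, eigenvalue M l -> `|l| < K.
Proof.
exists (cauchy_bound (char_poly M)) => l; rewrite eigenvalue_root_char => /rootP.
by apply: cauchy_boundP; rewrite monic_neq0 ?char_poly_monic.
Qed.

Lemma eigenvalueN (F : fieldType) (n : nat) (M : 'M[F]_n) (l : F) :
  eigenvalue (- M) l = eigenvalue M (- l).
Proof.
by apply/eigenvalueP/eigenvalueP => -[v vM v0]; exists v => //; move: vM;
  rewrite mulmxN scaleNr => /eqP; rewrite -?eqr_oppLR ?opprK => /eqP // <-;
  rewrite opprK.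
Qed.

(** Row [i] of [P] is a left eigenvector; it is nonzero because [P] is invertible. *)
Lemma eigenvalue_diag_conj (F : fieldType) (n : nat) (P : 'M[F]_n)
    (d : 'rV[F]_n) (i : 'I_n) :
  P \in unitmx -> eigenvalue (invmx P *m diag_mx d *m P) (d 0 i).
Proof.
move=> Pu; apply/eigenvalueP; exists (row i P).
  by rewrite !mulmxA -row_mul mulmxV // row1 -rowE row_diag_mx -scalemxAl -rowE.
apply/eqP => Pi0; have := row_mul i P (invmx P).
rewrite Pi0 mul0mx mulmxV // row1 => /matrixP/(_ 0 i)/eqP.
by rewrite !mxE !eqxx oner_eq0.
Qed.

(** In the spectral coordinates [w] of [u] the two forms become the sums of [d_j |w_j|^2] and of
    [|w_j|^2], and each [d_j] is a real eigenvalue, hence below [r]. *)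
Lemma hermitian_form_lt (C : numClosedFieldType) (n : nat) (M : 'M[C]_n)
    (r : C) (u : 'rV[C]_n) :
  M \is hermsymmx -> {in Num.real, forall l, eigenvalue M l -> l < r} ->
  u != 0 -> (u *m M *m u ^t*) 0 0 < r * (u *m u ^t*) 0 0.
Proof.
move=> Mherm Mlt u0.
set P := spectralmx M; set d := spectral_diag M.
have Pu : P \is unitarymx := spectral_unitarymx M.
have Punit := unitarymx_unit Pu.
have ME : M = invmx P *m diag_mx d *m P.
  exact/orthomx_spectralP/hermitian_normalmx.
have dlt i : d 0 i < r.
  apply: Mlt; first exact: (mxOverP (hermitian_spectral_diag_real Mherm)).
  by rewrite {1}ME eigenvalue_diag_conj.
pose w := u *m invmx P.
have uE : u = w *m P by rewrite mulmxKV.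
have wC : P *m u ^t* = w ^t*.
  by rewrite uE trmx_mul map_mxM mulmxA (unitarymxP Pu) mul1mx.
have -> : u *m M *m u ^t* = w *m diag_mx d *m w ^t*.
  by rewrite ME -wC /w !mulmxA.
have -> : u *m u ^t* = w *m w ^t* by rewrite {1}uE -mulmxA wC.
have {ME wC} [i wi0] : exists i, w 0 i != 0.
  apply/existsP; apply: contraNT u0; rewrite negb_exists => /forallP w0.
  rewrite uE (_ : w = 0) ?mul0mx //.
  by apply/rowP => j; rewrite [RHS]mxE; apply/eqP; rewrite -[_ == _]negbK.
(* The term of a nonzero coordinate [i] is split off: it gives the strict inequality, the others
   only weak ones. *)
clearbody w; rewrite mul_mx_diag !mxE mulr_sumr (bigD1 i) //= [ltRHS](bigD1 i) //=.
apply: ltr_leD; last apply: ler_sum => j _.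
  by rewrite !mxE mulrAC [ltLHS]mulrC ltr_pM2r ?mul_conjC_gt0.
by rewrite !mxE mulrAC [leLHS]mulrC ler_wpM2r ?mul_conjC_ge0 ?ltW.
Qed.

(** Over [R[i]] the matrix becomes Hermitian, and a real eigenvalue of the complexified matrix is
    already an eigenvalue of [M]. *)
Lemma symmetric_form_lt (R : rcfType) (n : nat) (M : 'M[R]_n) (r : R)
    (x : 'cV[R]_n) :
  M^T = M -> (forall l, eigenvalue M l -> l < r) -> x != 0 ->
  (x^T *m M *m x) 0 0 < r * (x^T *m x) 0 0.
Proof.
move=> Msym Mlt x0.
pose f : {rmorphism R -> R[i]} := real_complex R.
have freal a : f a \is Num.real by apply/complex_realP; exists a.
have xC : (map_mx f x)^T ^t* = map_mx f x.
  by apply/matrixP => i j; rewrite !mxE conj_Creal.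
rewrite -ltcR rmorphM /=.
have fE (A : 'M[R]_1) : (A 0 0)%:C%C = (map_mx f A) 0 0 by rewrite mxE.
rewrite !fE !map_mxM -map_trmx.
have := @hermitian_form_lt _ _ (map_mx f M) (f r) (map_mx f x)^T.
rewrite xC; apply.
- apply: realsym_hermsym.
    by apply/is_hermitianmxP; rewrite expr0 scale1r map_mx_id // map_trmx Msym.
  by apply/mxOverP => i j; rewrite mxE.
- move=> l /complex_realP[a ->]; rewrite -[a%:C%C]/(f a) eigenvalue_map.
  by move/Mlt; rewrite -ltcR.
- by rewrite map_trmx map_mx_eq0 trmx_eq0.
Qed.

Lemma sqnormE (R : realDomainType) (n : nat) (x : 'cV[R]_n) :
  (x^T *m x) 0 0 = \sum_i x i 0 ^+ 2.
Proof. by rewrite mxE; apply: eq_bigr => i _; rewrite mxE expr2. Qed.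

Lemma sigma_max_ge0 (R : realType) (n : nat) (A : 'M[R]_n) : 0 <= sigma_max A.
Proof.
(* [sup] defaults to 0 on a set that is empty (as for [n = 0]) or unbounded. *)
have [[l Al]|A0] := pselect (singular_values A !=set0)%classic; last first.
  by rewrite /sigma_max sup_out // => -[].
have [ubA|nub] := pselect (has_ubound (singular_values A)); last first.
  by rewrite /sigma_max sup_out // => -[].
apply: le_trans (ub_le_sup ubA Al).
by case: Al => a _ <-; rewrite sqrtr_ge0.
Qed.

Lemma sigma_max_ge (R : realType) (n : nat) (A : 'M[R]_n) (l : R) :
  eigenvalue (A^T *m A) l -> Num.sqrt l <= sigma_max A.
Proof.
move=> Al; apply: ub_le_sup; last by exists l.
have [K KA] := eigenvalue_bounded (A^T *m A).
exists (Num.sqrt K) => _ [a Aa <-]; apply: ler_wsqrtr.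
exact: le_trans (ler_norm _) (ltW (KA _ Aa)).
Qed.

Lemma sigma_min_le (R : realType) (n : nat) (A : 'M[R]_n) (l : R) :
  eigenvalue (A^T *m A) l -> sigma_min A <= Num.sqrt l.
Proof.
move=> Al; apply: ge_inf; last by exists l.
by exists 0 => _ [a _ <-]; rewrite sqrtr_ge0.
Qed.

Lemma sqnorm_mul_lt (R : realType) (n : nat) (A : 'M[R]_n) (s : R)
    (x : 'cV[R]_n) : sigma_max A < s -> x != 0 ->
  ((A *m x)^T *m (A *m x)) 0 0 < s ^+ 2 * (x^T *m x) 0 0.
Proof.
move=> As x0; rewrite trmx_mul mulmxA -(mulmxA x^T).
have s_gt0 : 0 < s := le_lt_trans (sigma_max_ge0 A) As.
apply: symmetric_form_lt => // [|l Al]; first by rewrite trmx_mul trmxK.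
rewrite -ltr_sqrt ?exprn_gt0 // sqrtr_sqr gtr0_norm //.
exact: le_lt_trans (sigma_max_ge Al) As.
Qed.

Lemma sqnorm_mul_gt (R : realType) (n : nat) (A : 'M[R]_n) (s : R)
    (x : 'cV[R]_n) : 0 <= s -> s < sigma_min A -> x != 0 ->
  s ^+ 2 * (x^T *m x) 0 0 < ((A *m x)^T *m (A *m x)) 0 0.
Proof.
move=> s_ge0 sA x0; rewrite trmx_mul mulmxA -(mulmxA x^T).
(* Negating the matrix turns the upper bound on the form into a lower bound. *)
have := @symmetric_form_lt _ _ (- (A^T *m A)) (- s ^+ 2) x.
rewrite mulNr mulmxN mulNmx [X in X < _]mxE ltrN2; apply => //.
  by rewrite linearN /= trmx_mul trmxK.
move=> l; rewrite eigenvalueN ltrNr => Al.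
have sl : s < Num.sqrt (- l) := lt_le_trans sA (sigma_min_le Al).
(* [Num.sqrt] vanishes on negative numbers, so a positive root forces a positive argument. *)
have l_gt0 : 0 < - l by rewrite -sqrtr_gt0 (le_lt_trans s_ge0).
by rewrite -ltr_sqrt // sqrtr_sqr ger0_norm.
Qed.

Theorem theorem9 (R : realType) (n : nat) (A B : 'M[R]_n) (b : 'cV[R]_n)
  (B_nonsing : B \in unitmx)
  (Bb_ge0 : forall i : 'I_n, 0 <= (invmx B *m b) i 0)
  (Bb_neq0 : invmx B *m b <> 0)
  (sigma_lt : sigma_max A < sigma_min B) :
  ~ exists x : 'cV[R]_n, A *m x - B *m absmx x = b.
Proof.
case=> x xE; set c := invmx B *m b in Bb_ge0 Bb_neq0.
have Bc : B *m c = b by rewrite mulKVmx.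
clearbody c.
pose z := absmx x + c.
have Bz : B *m z = A *m x by rewrite mulmxDr Bc -xE addrC subrK.
have xz : (x^T *m x) 0 0 <= (z^T *m z) 0 0.
  (* Entrywise, [x_i^2 = |x_i|^2] and [0 <= |x_i| <= |x_i| + c_i]. *)
  rewrite !sqnormE; apply: ler_sum => i _; rewrite -real_normK ?num_real //.
  by rewrite lerXn2r ?nnegrE // !mxE ?addr_ge0 ?lerDl // Bb_ge0.
have z0 : z != 0.
  apply/eqP => zE; apply: Bb_neq0; apply/colP => i.
  have /colP/(_ i)/eqP := zE.
  by rewrite !mxE paddr_eq0 // => /andP[_ /eqP].
have /midf_lt[s1 s2] := sigma_lt.
set s := (_ + _) / _ in s1 s2.
have s_gt0 : 0 < s := le_lt_trans (sigma_max_ge0 A) s1.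
have := sqnorm_mul_gt (ltW s_gt0) s2 z0; rewrite Bz; apply/negP; rewrite -leNgt.
apply: le_trans (ler_wpM2l (exprn_ge0 2 (ltW s_gt0)) xz).
(* The strict bound needs a nonzero vector; for [x = 0] both sides are 0. *)
have [->|x0] := eqVneq x 0; last exact/ltW/sqnorm_mul_lt.
by rewrite !mulmx0 !mxE mulr0.
Qed.
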